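(* In the setting described in the context (discrete or continuous case, with $\Pi_r^Xx\to x$ for all $x\in X$ as $r$ increases), assume $L$ is invertible. 1. For any $y\in\mathcal{R}(L)=\mathcal{D}(L^{-1})$, if $L$ is bounded, then $\|L\Pi_r^XL^{-1}y-y\|_Y\to0$ as $r$ increases. In addition, if $\mathcal{R}(L)$ is dense in $Y$ and $\{L\Pi_r^XL^{-1}\}$ is uniformly bounded, then $L\Pi_r^XL^{-1}y\to y$ for all $y\in Y$. 2. For any $x\in\mathcal{D}(L)=\mathcal{R}(L^{-1})$, if $L^{-1}$ is bounded and $\Pi_r^Yy\to y$ for all $y\in Y$ as $r$ increases, then $\|L^{-1}\Pi_r^YLx-x\|_X\to0$ as $r$ increases. In addition, if $\mathcal{D}(L)$ is dense in $X$ and $\{L^{-1}\Pi_r^YL\}$ is uniformly bounded, then $L^{-1}\Pi_r^YLx\to x$ for all $x\in X$. (In each item, the hypotheses of the ''in addition'' sentence are added to those of the preceding sentence.)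
   Context: Scalars are $\mathbb{K}=\mathbb{R}$ or $\mathbb{C}$; inner products are linear in the first argument. $X,Y$ are separable Hilbert spaces and $L:\mathcal{D}(L)\subset X\to Y$ is a linear operator, possibly unbounded. A ''bounded'' operator is by convention defined on the whole space. ''Invertible'' means injective, with $L^{-1}:\mathcal{D}(L^{-1})=\mathcal{R}(L)\subset Y\to X$; thus ''$L^{-1}$ bounded'' means $\mathcal{R}(L)=Y$ and $L^{-1}:Y\to X$ is bounded. Discrete case: $s\ge1$, weights $\gamma_1,\dots,\gamma_s>0$, $S=\mathbb{K}^s$ with $(u,v)_S=\sum_{j=1}^s\gamma_ju_j\overline{v_j}$, data $\{w_j\}_{j=1}^s\subset\mathcal{D}(L)$, and POD operator $K:S\to X$, $Kf=\sum_{j=1}^s\gamma_jf_jw_j$. Continuous case: $\mathcal{O}\subset\mathbb{R}^d$ open, $m\ge1$, $S=L^2(\mathcal{O};\mathbb{K}^m)$, data $\{w_j\}_{j=1}^m\subset L^2(\mathcal{O};X)$, POD operator $K:S\to X$, $Kf=\sum_{j=1}^m\int_{\mathcal{O}}f_j(t)w_j(t)\,dt$; it is assumed that $w_j(t)\in\mathcal{D}(L)$ a.e., $Lw_j\in L^2(\mathcal{O};Y)$, and for all $f\in S$, $Kf\in\mathcal{D}(L)$ and $LKf=\sum_{j=1}^m\int_{\mathcal{O}}f_j(t)Lw_j(t)\,dt$. In both cases $K$ is compact with singular value decomposition $Kf=\sum_{k\ge1}\sigma_k(f,f_k)_S\varphi_k$, $\sigma_1\ge\sigma_2\ge\dots\ge0$,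 with orthonormal singular vectors $\{f_k\}\subset S$, $\{\varphi_k\}\subset X$. $s_X=\mathrm{rank}(K)\in\mathbb{N}\cup\{\infty\}$, so $\sigma_k>0$ exactly for $k\le s_X$, and then $\varphi_k=\sigma_k^{-1}Kf_k\in\mathcal{D}(L)$. For each positive integer $r$ with $\sigma_r>0$: $X_r=\mathrm{span}\{\varphi_k\}_{k=1}^r$; $\Pi_r^X:X\to X$ is the orthogonal projection onto $X_r$; $Y_r=LX_r$; $\Pi_r^Y:Y\to Y$ is a bounded linear projection onto $Y_r$, not necessarily orthogonal. The operators $L\Pi_r^XL^{-1}$ and $L^{-1}\Pi_r^YL$ are initially defined on $\mathcal{D}(L^{-1})$ and $\mathcal{D}(L)$ respectively; a family of them is uniformly bounded if each extends to a bounded linear operator on the whole space (denoted by the same symbol) with operator norm at most $C$, $C$ independent of $r$. Standing assumption for pointwise convergence: $\{\varphi_k\}$ is an orthonormal basis of $X$ in the sense that $\Pi_r^Xx\to x$ for all $x\in X$ as $r$ increases. ''As $r$ increases'' means $r=1,2,\dots$ with $r\le s_X$: if $s_X=\infty$ it is the limit $r\to\infty$; if $s_X<\infty$, convergence to a limit means that the limit is attained at $r=s_X$. *)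

(* Defs.v *)
From HB Require Import structures.
From mathcomp Require Import all_boot all_order all_algebra complex.
From mathcomp Require Import all_classical all_reals all_analysis.
Set Implicit Arguments.
Unset Strict Implicit.
Unset Printing Implicit Defensive.
Import Order.TTheory GRing.Theory Num.Theory.
Import numFieldNormedType.Exports.
Local Open Scope classical_set_scope.
Local Open Scope ring_scope.

(* The Borel sigma-algebra of R^d, generated by the coordinate maps, on the type
   that already carries the library's (product) topology. *)
Section rV_measurable.
Context (R : realType) (d : nat).
Definition rV_coord (i : 'I_d) (v : 'rV[R]_d) : R := v ord0 i.

Let rV0 : g_sigma_preimage rV_coord set0.
Proof. exact: sigma_algebra0. Qed.
Let rVC A : g_sigma_preimage rV_coord A -> g_sigma_preimage rV_coord (~` A).
Proof. exact: sigma_algebraC. Qed.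
Let rV_bigcup (F : _^nat) : (forall i, g_sigma_preimage rV_coord (F i)) ->
  g_sigma_preimage rV_coord (\bigcup_i (F i)).
Proof. exact: sigma_algebra_bigcup. Qed.

HB.instance Definition _ := @isMeasurable.Build default_measure_display
  'rV[R]_d (g_sigma_preimage rV_coord) rV0 rVC rV_bigcup.

Lemma measurable_rV_coord (i : 'I_d) : measurable_fun setT (rV_coord i).
Proof.
move=> _ Y mY; rewrite setTI; apply: sub_sigma_algebra => /=.
rewrite -bigcup_seq/=; exists i => /=; first by rewrite mem_index_enum.
by exists Y => //; rewrite setTI.
Qed.

Lemma measurable_rV d' (T : measurableType d') (f : T -> 'rV[R]_d) :
  (forall i, measurable_fun setT (rV_coord i \o f)) -> measurable_fun setT f.
Proof.
move=> mf; apply: (@measurability _ _ _ _ _ _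
  (\big[setU/set0]_(i < d) preimage_set_system setT (rV_coord i) measurable)) => //.
move=> _ [B + <-]; rewrite -bigcup_seq => -[i _ [Y mY <-]].
by have := mf i measurableT _ mY; rewrite !setTI.
Qed.
End rV_measurable.

Lemma sigma_finite_product (R : realType) d1 d2 (T1 : measurableType d1)
    (T2 : measurableType d2) (m1 : {sigma_finite_measure set T1 -> \bar R})
    (m2 : {sigma_finite_measure set T2 -> \bar R}) :
  sigma_finite setT (m1 \x m2)%E.
Proof.
have /sigma_finiteP[F [TF ndF Foo]] := sigma_finiteT m1.
have /sigma_finiteP[G [TG ndG Goo]] := sigma_finiteT m2.
exists (fun n => F n `*` G n).
 rewrite -setXTT TF TG predeqE => -[x y]; split.
    move=> [/= [n _ Fnx] [k _ Gky]]; exists (maxn n k) => //; split.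
    - by move: x Fnx; exact/subsetPset/ndF/leq_maxl.
    - by move: y Gky; exact/subsetPset/ndG/leq_maxr.
  by move=> [n _ []/= ? ?]; split; exists n.
move=> k; have [? ?] := Foo k; have [? ?] := Goo k.
split; first exact: measurableX.
by rewrite product_measure1E// lte_mul_pinfty// ge0_fin_numE.
Qed.

Section lebesgue_rV.
Context (R : realType).

Definition rV_cons (d : nat) (p : R * 'rV[R]_d) : 'rV[R]_d.+1 :=
  \row_i (if unlift ord0 i is Some j then p.2 ord0 j else p.1).
Definition rV_uncons (d : nat) (v : 'rV[R]_d.+1) : R * 'rV[R]_d :=
  (v ord0 ord0, \row_j v ord0 (lift ord0 j)).

Lemma rV_consK d : cancel (@rV_cons d) (@rV_uncons d).
Proof.
move=> [x v]; rewrite /rV_uncons /rV_cons mxE unlift_none; congr pair.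
by apply/rowP => j; rewrite !mxE liftK.
Qed.

Lemma measurable_rV_cons d : measurable_fun setT (@rV_cons d).
Proof.
apply: measurable_rV => i.
have [j ->|->] := unliftP ord0 i.
  rewrite (_ : _ \o _ = rV_coord j \o snd); last first.
    by apply/funext => p; rewrite /= /rV_coord mxE liftK.
  exact: measurableT_comp (measurable_rV_coord j) measurable_snd.
rewrite (_ : _ \o _ = fst); first exact: measurable_fst.
by apply/funext => p; rewrite /= /rV_coord mxE unlift_none.
Qed.

Lemma measurable_rV_uncons d : measurable_fun setT (@rV_uncons d).
Proof.
apply/measurable_fun_pairP; split.
  exact: (measurable_rV_coord ord0).
apply: measurable_rV => j.
rewrite (_ : _ \o _ = rV_coord (lift ord0 j)); first exact: measurable_rV_coord.
by apply/funext => v; rewrite /= /rV_coord !mxE.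
Qed.

Section step.
Variables (d : nat) (m : {sigma_finite_measure set 'rV[R]_d -> \bar R}).

Definition lebesgue_rV_step : set 'rV[R]_d.+1 -> \bar R :=
  pushforward (lebesgue_measure \x m)%E (@rV_cons d).

Let step_measurable (A : set 'rV[R]_d.+1) :
  measurable A -> measurable (@rV_cons d @^-1` A).
Proof.
by move=> mA; rewrite -[X in measurable X]setTI; exact: measurable_rV_cons.
Qed.

Let step0 : lebesgue_rV_step set0 = 0%E.
Proof. by rewrite /lebesgue_rV_step /pushforward preimage_set0 measure0. Qed.

Let step_ge0 A : (0 <= lebesgue_rV_step A)%E.
Proof. by rewrite /lebesgue_rV_step /pushforward; exact: measure_ge0. Qed.

Let step_sigma_additive : semi_sigma_additive lebesgue_rV_step.
Proof.
move=> F mF tF mUF; rewrite /lebesgue_rV_step /pushforward preimage_bigcup.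
apply: measure_semi_sigma_additive.
- by move=> n; exact: step_measurable.
- apply/trivIsetP => /= i j _ _ ij; rewrite -preimage_setI.
  by move/trivIsetP : tF => /(_ _ _ _ _ ij) ->//; rewrite preimage_set0.
- by rewrite -preimage_bigcup; exact: step_measurable.
Qed.

HB.instance Definition _ := isMeasure.Build _ _ _ lebesgue_rV_step
  step0 step_ge0 step_sigma_additive.

Let step_sigma_finite : sigma_finite setT lebesgue_rV_step.
Proof.
have [F FT Foo] : sigma_finite setT (lebesgue_measure \x m)%E.
  exact: (sigma_finite_product lebesgue_measure m).
exists (fun k => @rV_uncons d @^-1` F k).
  by rewrite -preimage_bigcup -FT preimage_setT.
move=> k; have [mF Fk] := Foo k; split.
  by rewrite -[X in measurable X]setTI; exact: measurable_rV_uncons.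
rewrite /lebesgue_rV_step /pushforward -comp_preimage.
by rewrite (_ : _ \o _ = id)//; apply/funext => p /=; rewrite rV_consK.
Qed.

HB.instance Definition _ := Measure_isSigmaFinite.Build _ _ _ lebesgue_rV_step
  step_sigma_finite.

End step.

(* Lebesgue measure on the Borel sets of R^d. *)
Fixpoint lebesgue_rV (d : nat) : {sigma_finite_measure set 'rV[R]_d -> \bar R} :=
  match d with
  | 0 => \d_(0 : 'rV[R]_0)
  | d'.+1 => lebesgue_rV_step (lebesgue_rV d')
  end.

End lebesgue_rV.

Inductive field_kind := RealField | ComplexField.

Definition scalars (R : realType) (k : field_kind) : numFieldType :=
  match k with RealField => R | ComplexField => R[i] end.

Definition scalar_conj (R : realType) (k : field_kind) :
    scalars R k -> scalars R k :=
  match k with RealField => idfun | ComplexField => @conjc R end.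

Definition scalar_Re (R : realType) (k : field_kind) : scalars R k -> R :=
  match k with RealField => idfun | ComplexField => @complex.Re R end.

Definition scalar_of_real (R : realType) (k : field_kind) : R -> scalars R k :=
  match k with RealField => idfun | ComplexField => fun x => (x +i* 0)%C end.

Arguments scalar_conj {R k}.
Arguments scalar_Re {R k}.
Arguments scalar_of_real {R} k.

(* In the library, norms take their values in the field of scalars, and over
   R[i] the assertions 0 <= z and 0 < z entail that z is real. This is used for
   norms, operator bounds, weights and singular values. The form [inner] is
   linear in its first argument. *)
Structure sepHilbert (R : realType) (k : field_kind) := SepHilbert {
  hilbert_carrier :> completeNormedModType (scalars R k) ;
  inner : {dot hilbert_carrier for @scalar_conj R k} ;
  sqr_norm_inner : forall x : hilbert_carrier, `|x| ^+ 2 = inner x x ;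
  hilbert_separable : exists2 A : set hilbert_carrier, countable A & dense A
}.
Arguments inner {R k s}.

Section bochner.
Context d (T : measurableType d) (R : realType) (k : field_kind).
Variables (mu : {measure set T -> \bar R}) (D : set T).
Variable V : normedModType (scalars R k).

Definition real_norm (v : V) : R := scalar_Re `|v|.

Definition simple_on (s : T -> V) : Prop :=
  finite_set (s @` D) /\
  forall v, measurable (D `&` s @^-1` [set v]) /\
            (v != 0 -> (mu (D `&` s @^-1` [set v]) < +oo)%E).

Definition simple_integral (s : T -> V) : V :=
  \sum_(v \in s @` D)
    scalar_of_real k (fine (mu (D `&` s @^-1` [set v]))) *: v.

Definition strongly_measurable (f : T -> V) : Prop :=
  exists2 s : (T -> V)^nat, (forall n, simple_on (s n)) &
    {ae mu, forall t, D t -> s n t @[n --> \oo] --> f t}.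

Definition has_bochner_integral (f : T -> V) (v : V) : Prop :=
  strongly_measurable f /\
  exists s : (T -> V)^nat,
    [/\ forall n, simple_on (s n),
        (\int[mu]_(t in D) (real_norm (f t - s n t))%:E)%E @[n --> \oo] --> 0%E &
        simple_integral (s n) @[n --> \oo] --> v].

(* Conventionally 0 when f is not Bochner integrable. *)
Definition bochner (f : T -> V) : V := xget 0 [set v | has_bochner_integral f v].

Definition L2 : set (T -> V) := [set f | strongly_measurable f /\
  (\int[mu]_(t in D) (real_norm (f t) ^+ 2)%:E < +oo)%E].

End bochner.

Section linop.
Context (R : realType) (k : field_kind).
Local Notation K := (scalars R k).

(* The values of [linop_fun] outside the domain are meaningless. *)
Record linop (X Y : normedModType K) := Linop {
  linop_fun :> X -> Y ;
  dom : set X ;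
  dom0 : dom 0 ;
  domP : forall (a : K) x y, dom x -> dom y -> dom (a *: x + y) ;
  linopP : forall (a : K) x y, dom x -> dom y ->
    linop_fun (a *: x + y) = a *: linop_fun x + linop_fun y
}.

Definition ran (X Y : normedModType K) (L : linop X Y) : set Y := L @` dom L.

Definition invertible (X Y : normedModType K) (L : linop X Y) : Prop :=
  set_inj (dom L) L.

Definition bounded_operator (X Y : normedModType K) (L : linop X Y) : Prop :=
  dom L = setT /\ exists C : K, forall x, `|L x| <= C * `|x|.

Section inverse.
Context (X Y : normedModType K) (L : linop X Y).
Hypothesis Linj : invertible L.

Definition inv_fun (y : Y) : X := xget 0 [set x | dom L x /\ L x = y].

Lemma inv_funP y : ran L y -> dom L (inv_fun y) /\ L (inv_fun y) = y.
Proof.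
move=> [x Lx xy].
exact: (@xgetPex _ 0 [set x | dom L x /\ L x = y] (ex_intro _ x (conj Lx xy))).
Qed.

Lemma linop0 : L 0 = 0.
Proof.
have := linopP 1 (dom0 L) (dom0 L); rewrite !scale1r addr0 => /eqP.
by rewrite -subr_eq0 opprD addrA subrr add0r oppr_eq0 => /eqP.
Qed.

Lemma ran0 : ran L 0.
Proof. by exists 0; [exact: dom0 | exact: linop0]. Qed.

Lemma ranP (a : K) x y : ran L x -> ran L y -> ran L (a *: x + y).
Proof.
move=> [u Lu <-] [v Lv <-]; exists (a *: u + v); first exact: domP.
exact: linopP.
Qed.

Lemma inv_fun_linear (a : K) x y : ran L x -> ran L y ->
  inv_fun (a *: x + y) = a *: inv_fun x + inv_fun y.
Proof.
move=> rx ry.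
have [dx ex] := inv_funP rx; have [dy ey] := inv_funP ry.
have [dz ez] := inv_funP (ranP a rx ry).
apply: Linj; rewrite ?inE//; first exact: domP.
by rewrite ez linopP// ex ey.
Qed.

Definition inverse : linop Y X :=
  @Linop Y X inv_fun (ran L) ran0 ranP inv_fun_linear.

End inverse.
End linop.

Section pod.
Context (R : realType) (k : field_kind).
Local Notation K := (scalars R k).

(* An operator K : S -> X together with the inner product of S. The space S
   consists of the elements of [pod_space] in the type [pod_carrier]; for
   S = L^2 these are square integrable functions, not classes modulo almost
   everywhere equality. *)
Record pod_operator (X : sepHilbert R k) := PodOperator {
  pod_carrier : Type ;
  pod_space : set pod_carrier ;
  pod_inner : pod_carrier -> pod_carrier -> K ;
  pod_map :> pod_carrier -> X
}.

Arguments pod_space {X} p _.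
Arguments pod_map {X} p _.

Definition discrete_pod (X : sepHilbert R k) (s : nat) (gamma : 'I_s -> K)
    (w : 'I_s -> X) : pod_operator X :=
  @PodOperator X 'rV[K]_s setT
    (fun u v => \sum_(j < s) gamma j * u ord0 j * scalar_conj (v ord0 j))
    (fun f => \sum_(j < s) (gamma j * f ord0 j) *: w j).

Section continuous_pod.
Context (d : nat) (O : set 'rV[R]_d) (m : nat).
Let mu := lebesgue_rV R d.

(* sum_j \int_O f_j(t) w_j(t) dt *)
Definition pod_integral (X : sepHilbert R k) (w : 'I_m -> 'rV[R]_d -> X)
    (f : 'rV[R]_d -> 'rV[K]_m) : X :=
  \sum_(j < m) bochner mu O (fun t => f t ord0 j *: w j t).

Definition continuous_pod (X : sepHilbert R k) (w : 'I_m -> 'rV[R]_d -> X) :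
    pod_operator X :=
  @PodOperator X ('rV[R]_d -> 'rV[K]_m)
    [set f | forall j, L2 mu O (fun t => f t ord0 j : K^o)]
    (fun f g => \sum_(j < m)
       bochner mu O (fun t => f t ord0 j * scalar_conj (g t ord0 j) : K^o))
    (pod_integral w).

End continuous_pod.

Inductive pod_setting (X Y : sepHilbert R k) (L : linop X Y) :
    pod_operator X -> Prop :=
| DiscreteCase (s : nat) (gamma : 'I_s -> K) (w : 'I_s -> X) :
    (1 <= s)%N ->
    (forall j, 0 < gamma j) ->
    (forall j, dom L (w j)) ->
    pod_setting L (discrete_pod gamma w)
| ContinuousCase (d : nat) (O : set 'rV[R]_d) (m : nat)
    (w : 'I_m -> 'rV[R]_d -> X) :
    open O ->
    (1 <= m)%N ->
    (forall j, L2 (lebesgue_rV R d) O (w j)) ->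
    (forall j, {ae lebesgue_rV R d, forall t, O t -> dom L (w j t)}) ->
    (forall j, L2 (lebesgue_rV R d) O (fun t => L (w j t))) ->
    (forall f, pod_space (continuous_pod O w) f ->
       dom L (continuous_pod O w f) /\
       L (continuous_pod O w f) = pod_integral O (fun j t => L (w j t)) f) ->
    pod_setting L (continuous_pod O w).

(* Indices start at 1; the terms of index 0 of the three sequences are ignored.
   Singular vectors belonging to zero singular values are irrelevant and left
   unconstrained, since S or X may be finite dimensional. *)
Record is_svd (X : sepHilbert R k) (P : pod_operator X) (sigma : nat -> K)
    (f : nat -> pod_carrier P) (phi : nat -> X) : Prop := IsSvd {
  svd_ge0 : forall i, (1 <= i)%N -> 0 <= sigma i ;
  svd_nonincreasing : forall i, (1 <= i)%N -> sigma i.+1 <= sigma i ;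
  svd_space : forall i, (1 <= i)%N -> 0 < sigma i -> pod_space P (f i) ;
  svd_orthonormal_f : forall i j, (1 <= i)%N -> (1 <= j)%N ->
    0 < sigma i -> 0 < sigma j -> pod_inner (f i) (f j) = (i == j)%:R ;
  svd_orthonormal_phi : forall i j, (1 <= i)%N -> (1 <= j)%N ->
    0 < sigma i -> 0 < sigma j -> inner (phi i) (phi j) = (i == j)%:R ;
  svd_expansion : forall g, pod_space P g ->
    (\sum_(1 <= i < n.+1) (sigma i * pod_inner g (f i)) *: phi i)
      @[n --> \oo] --> P g
}.

Definition lin_indep (V : lmodType K) (n : nat) (v : 'I_n -> V) : Prop :=
  forall c : 'I_n -> K, \sum_(i < n) c i *: v i = 0 -> forall i, c i = 0.

(* [None] stands for infinity. *)
Definition has_dim (V : lmodType K) (A : set V) (s : option nat) : Prop :=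
  match s with
  | Some n => exists v : 'I_n -> V, [/\ forall i, A (v i), lin_indep v &
      forall x, A x -> exists c : 'I_n -> K, x = \sum_(i < n) c i *: v i]
  | None => forall n, exists v : 'I_n -> V, (forall i, A (v i)) /\ lin_indep v
  end.

Definition has_rank (X : sepHilbert R k) (P : pod_operator X) : option nat -> Prop :=
  has_dim (P @` pod_space P).

(* span {phi_1, ..., phi_r}; it is {0} for r = 0 *)
Definition span_first (V : lmodType K) (phi : nat -> V) (r : nat) : set V :=
  [set x | exists c : nat -> K, x = \sum_(1 <= i < r.+1) c i *: phi i].

Definition orthogonal_projection (X : sepHilbert R k) (V : set X) (Q : X -> X) :
    Prop :=
  forall x, V (Q x) /\ forall v, V v -> inner (x - Q x) v = 0.

Definition bounded_projection (Y : normedModType K) (V : set Y)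
    (Q : {linear Y -> Y}) : Prop :=
  [/\ exists C : K, forall y, `|Q y| <= C * `|y|,
      forall y, Q (Q y) = Q y &
      range Q = V].

(* r <= s_X. The value r = 0, for which the spaces X_r and Y_r are {0}, only
   plays a role when s_X = 0. *)
Definition le_rank (r : nat) (s : option nat) : Prop :=
  if s is Some n then (r <= n)%N else True.

Definition as_r_increases (T : topologicalType) (s : option nat) (u : nat -> T)
    (l : T) : Prop :=
  if s is Some n then u n = l else u @ \oo --> l.

(* The maps [T r] are bounded linear extensions of [A r], initially defined on
   [D], to the whole space, with operator norms bounded uniformly in [r]. *)
Definition uniformly_bounded_extension (V : normedModType K) (s : option nat)
    (D : set V) (A : nat -> V -> V) (T : nat -> {linear V -> V}) : Prop :=
  (forall r, le_rank r s -> forall v, D v -> T r v = A r v) /\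
  exists C : K, forall r, le_rank r s -> forall v, `|T r v| <= C * `|v|.

End pod.

(* Main.v *)
Require Import Defs.
From mathcomp Require Import all_boot all_order all_algebra complex.
From mathcomp Require Import all_classical all_reals all_analysis.
Import Order.TTheory GRing.Theory Num.Theory.
Import numFieldNormedType.Exports.
Local Open Scope classical_set_scope.
Local Open Scope ring_scope.

(** Write x = L^-1 y. If L is bounded, then
      L (PiX r (L^-1 y)) - y = L (PiX r x) - L x,
    and this tends to 0 because PiX r x tends to x and L is continuous. In the
    same way, if L^-1 is bounded, then
      L^-1 (PiY r (L x)) - x = L^-1 (PiY r (L x)) - L^-1 (L x)
    tends to 0 because PiY r (L x) tends to L x. Both are instances of
    [bounded_operator_as_r_increases].

    This settles convergence on the initial domains of the operators. When
    these domains are dense and the extensions are bounded by one constant,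
    convergence spreads to the whole space by the density half of the
    Banach-Steinhaus theorem, [uniformly_bounded_dense_as_r_increases].

    Finite and infinite rank are treated together through the epsilon
    characterization [as_r_increasesP] of convergence as r increases. *)

Section convergence.
Context {R : realType} {k : field_kind}.
Local Notation K := (scalars R k).

(** Attaining the limit at r = n is convergence along the indices r <= n: the
    threshold r0 = n leaves only the index n, and vectors closer than every
    e > 0 are equal. *)
Lemma as_r_increasesP (V : normedModType K) (s : option nat) (u : nat -> V)
    (l : V) :
  as_r_increases s u l <->
  forall e : K, 0 < e -> exists2 r0, le_rank r0 s &
    forall r, (r0 <= r)%N -> le_rank r s -> `|l - u r| < e.
Proof.
case: s => [n|] /=; split.
- move=> un e e0; exists n => // r nr rn.
  have -> : r = n by apply/eqP; rewrite eqn_leq rn nr.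
  by rewrite un subrr normr0.
- move=> ul; apply/eqP/negPn/negP => unl.
  have lun : 0 < `|l - u n| by rewrite normr_gt0 subr_eq0 eq_sym.
  have [r0 r0n /(_ n r0n (leqnn n))] := ul _ lun.
  by rewrite ltxx.
- move=> /cvgrPdist_lt ul e e0.
  by have [r0 _ r0P] := ul _ e0; exists r0 => // r r0r _; exact: r0P.
- move=> ul; apply/cvgrPdist_lt => e e0.
  by have [r0 _ r0P] := ul _ e0; exists r0 => // r r0r; exact: r0P.
Qed.

(** The scalars are only partially ordered over R[i], so an operator bound C
    need not be comparable with 0 (on the zero space it is arbitrary); its
    modulus is a nonnegative bound. *)
Lemma ler_normr_bound {C a b : K} : 0 <= a -> 0 <= b -> a <= C * b ->
  a <= `|C| * b.
Proof.
move=> a0 b0 ab; rewrite -[b in X in _ <= X]ger0_norm// -normrM ger0_norm//.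
exact: le_trans ab.
Qed.

Lemma bounded_operator_as_r_increases {X Y : normedModType K} {A : linop X Y}
    {s : option nat} {u : nat -> X} {l : X} :
  bounded_operator A -> as_r_increases s u l ->
  as_r_increases s (fun r => `|A (u r) - A l| : K^o) 0.
Proof.
move=> [domA [C AC]] /as_r_increasesP ul; apply/as_r_increasesP => e e0.
have domT x : dom A x by rewrite domA.
have C1 : 0 < `|C| + 1 by rewrite ltr_wpDl.
have [r0 r0s r0P] := ul (e / (`|C| + 1)) (divr_gt0 e0 C1).
exists r0 => // r r0r rs.
rewrite sub0r normrN normr_id.
have -> : A (u r) - A l = A (u r - l).
  have := linopP (- 1) (domT l) (domT (u r)).
  by rewrite !scaleN1r addrC => ->; rewrite addrC.
apply: le_lt_trans (_ : (`|C| + 1) * `|u r - l| < e).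
  apply: le_trans (ler_normr_bound (normr_ge0 _) (normr_ge0 _) (AC _)) _.
  by rewrite ler_wpM2r// lerDl.
by rewrite mulrC -ltr_pdivlMr// distrC r0P.
Qed.

(** Approximate v by z in D and split
      v - T r v = (v - z) + (z - T r z) + T r (z - v);
    the outer terms are small uniformly in r. *)
Lemma uniformly_bounded_dense_as_r_increases {V : normedModType K}
    {s : option nat} {D : set V} {A : nat -> V -> V}
    {T : nat -> {linear V -> V}} :
  uniformly_bounded_extension s D A T -> dense D ->
  (forall v, D v -> as_r_increases s (fun r => `|A r v - v| : K^o) 0) ->
  forall v, as_r_increases s (fun r => T r v) v.
Proof.
move=> [TA [C TC]] denseD AD v; apply/as_r_increasesP => e e0.
have C1 : 0 < `|C| + 1 by rewrite ltr_wpDl.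
have e2 : 0 < e / 2 by rewrite divr_gt0.
pose delta := e / 2 / (`|C| + 1).
have delta0 : 0 < delta by rewrite divr_gt0.
have [z [vz Dz]] : (ball v delta `&` D) !=set0.
  by apply: denseD; [exists v; exact: ballxx | exact: ball_open].
have {}vz : `|v - z| < delta by move: vz; rewrite -ball_normE.
have /as_r_increasesP /(_ _ e2) [r0 r0s r0P] := AD z Dz.
exists r0 => // r r0r rs.
have Az : `|z - T r z| < e / 2.
  by have := r0P r r0r rs; rewrite sub0r normrN normr_id -TA// distrC.
have Tzv : `|T r (z - v)| <= `|C| * `|v - z|.
  by rewrite (distrC v); apply: ler_normr_bound => //; exact: TC.
have -> : v - T r v = (z - T r z) + (T r (z - v) + (v - z)).
  by rewrite linearB addrCA [(z - _) + _]addrC subrKA addrC subrKA.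
apply: le_lt_trans (ler_normD _ _) _.
rewrite [ltRHS](splitr e); apply: ltrD => //.
apply: le_lt_trans (ler_normD _ _) _.
apply: le_lt_trans (_ : (`|C| + 1) * `|v - z| < _).
  by rewrite mulrDl mul1r lerD2r.
by rewrite mulrC -ltr_pdivlMr.
Qed.

End convergence.

Theorem theorem6p2 (R : realType) (k : field_kind) (X Y : sepHilbert R k)
    (L : linop X Y) (P : pod_operator X) (sigma : nat -> scalars R k)
    (f : nat -> pod_carrier P) (phi : nat -> X) (sX : option nat)
    (PiX : nat -> X -> X) (PiY : nat -> {linear Y -> Y})
    (hP : pod_setting L P) (hsvd : is_svd sigma f phi) (hsX : has_rank P sX)
    (hPiX : forall r, le_rank r sX ->
       orthogonal_projection (span_first phi r) (PiX r))
    (hPiY : forall r, le_rank r sX ->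
       bounded_projection (L @` span_first phi r) (PiY r))
    (hbasis : forall x, as_r_increases sX (fun r => PiX r x) x)
    (Linj : invertible L) :
  let Linv := inverse Linj in
  (bounded_operator L ->
     (forall y, ran L y ->
        as_r_increases sX
          (fun r => `|L (PiX r (Linv y)) - y| : (scalars R k)^o) 0) /\
     (dense (ran L) ->
        forall T : nat -> {linear Y -> Y},
        uniformly_bounded_extension sX (dom Linv)
          (fun r y => L (PiX r (Linv y))) T ->
        forall y, as_r_increases sX (fun r => T r y) y)) /\
  (bounded_operator Linv ->
     (forall y, as_r_increases sX (fun r => PiY r y) y) ->
     (forall x, dom L x ->
        as_r_increases sX
          (fun r => `|Linv (PiY r (L x)) - x| : (scalars R k)^o) 0) /\
     (dense (dom L) ->
        forall T : nat -> {linear X -> X},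
        uniformly_bounded_extension sX (dom L)
          (fun r x => Linv (PiY r (L x))) T ->
        forall x, as_r_increases sX (fun r => T r x) x)).
Proof.
have LK x : dom L x -> inverse Linj (L x) = x.
  move=> Lx; have [dx ex] := inv_funP (ex_intro2 _ _ x Lx erefl : ran L (L x)).
  by apply: (Linj); rewrite ?inE.
have LinvK y : ran L y -> L (inverse Linj y) = y by case/inv_funP.
move=> Linv; split=> [bL | bLinv PiYy].
  have cvgL y : ran L y ->
      as_r_increases sX (fun r => `|L (PiX r (Linv y)) - y| : (scalars R k)^o) 0.
    move=> Ly; have := bounded_operator_as_r_increases bL (hbasis (Linv y)).
    by rewrite LinvK.
  split=> // dL T TL.
  exact: (uniformly_bounded_dense_as_r_increases TL).
have cvgLinv x : dom L x ->
    as_r_increases sX (fun r => `|Linv (PiY r (L x)) - x| : (scalars R k)^o) 0.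
  move=> Lx; have := bounded_operator_as_r_increases bLinv (PiYy (L x)).
  by rewrite [_ (L x)]LK.
split=> // dL T TL.
exact: (uniformly_bounded_dense_as_r_increases TL).
Qed.
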